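(* Let $\boldsymbol{\mathscr X}\in\mathbb N_0^{N_1\times\cdots\times N_P}$, $N=N_1\cdots N_P$, and let $\ell$ be the loglikelihood of the rank one PCP model, $$\ell(\boldsymbol\theta)=\sum_{p=1}^P\boldsymbol x_p^\top\log(\boldsymbol a_p)-\prod_{p=1}^P\lambda_p+C,$$ where $\boldsymbol\theta=[\boldsymbol a_1^\top\cdots\boldsymbol a_P^\top]^\top$ has positive entries, $\boldsymbol x_p=\mathbf X_{(p)}\mathbf 1_{N/N_p}$, $\lambda_p=\mathbf 1_{N_p}^\top\boldsymbol a_p$, and $C$ does not depend on $\boldsymbol\theta$. If $\boldsymbol x_p$ is a positive vector for every $p\in\{1,\dots,P\}$, then the problem of maximizing $\ell(\boldsymbol\theta)$ over positive vectors $\boldsymbol\theta\in\mathbb R_+^{N_1+\cdots+N_P}$ subject to the multilinear constraint $$\lambda:=\lambda_1\cdots\lambda_P=\mathbf 1_N^\top\mathrm{vec}(\boldsymbol{\mathscr X})>0$$ has the solution (in terms of the rank one tensor formed from the maximizing factor vectors $\hat{\boldsymbol a}_1,\dots,\hat{\boldsymbol a}_P$) $$\widehat{\boldsymbol{\mathscr M}}=\hat{\boldsymbol a}_1\circ\cdots\circ\hat{\boldsymbol a}_P=\frac1{\lambda^{P-1}}\,\boldsymbol x_1\circ\cdots\circ\boldsymbol x_P .$$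
   Context: Rank one PCP model: independent entries $x_{\boldsymbol i}\sim\mathrm{Poisson}\big(\prod_{p=1}^P\boldsymbol a_p(i_p)\big)$, $\boldsymbol i=(i_1,\dots,i_P)$, with positive factor vectors $\boldsymbol a_p\in\mathbb R_+^{N_p}$ ($\mathbb R_+$ the positive reals). $\mathbf X_{(p)}\in\mathbb R^{N_p\times N/N_p}$ is the mode-$p$ matricization of $\boldsymbol{\mathscr X}$, so the entry $i_p$ of $\boldsymbol x_p$ is the sum of all entries of $\boldsymbol{\mathscr X}$ whose $p$-th index equals $i_p$. $\mathbf 1_n$ is the all-ones vector of length $n$; $\log$ of a vector is entrywise; $\circ$ is the outer product of vectors, i.e. $(\boldsymbol a_1\circ\cdots\circ\boldsymbol a_P)_{\boldsymbol i}=\prod_p\boldsymbol a_p(i_p)$. *)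

(* Defs.v *)
From HB Require Import structures.
From mathcomp Require Import all_boot all_order all_algebra.
From mathcomp Require Import reals exp poisson_distribution.

Set Implicit Arguments.
Unset Strict Implicit.
Unset Printing Implicit Defensive.
Import Order.TTheory GRing.Theory Num.Theory.
Local Open Scope ring_scope.

Definition midx (P : nat) (Nd : 'I_P -> nat) :=
  {dffun forall p : 'I_P, 'I_(Nd p)}.

Notation tensor Nd V := {ffun midx Nd -> V}.

Section Tensors.
Variables (P : nat) (Nd : 'I_P -> nat).

(* Position of a multi-index in the first-index-fastest (column-major)
   enumeration of the modes selected by A; the other modes are ignored. *)
Definition linidx (A : pred 'I_P) (i : midx Nd) : nat :=
  (\sum_(q | A q) i q * \prod_(m | A m && (m < q)) Nd m)%N.

(* Each sum in vec and matricization has exactly one term: by linidx_lt,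
   linidx_inj and counting, a multi-index is the same as a position in vec, and
   the same as a (row, column) pair in matricization (see vecE and
   matricizationE). *)
Definition vec (V : nmodType) (X : tensor Nd V) : 'cV[V]_(\prod_q Nd q)%N :=
  \col_c \sum_(i : midx Nd | linidx predT i == c) X i.

(* The number of columns is N / N_p. *)
Definition matricization (V : nmodType) (X : tensor Nd V) (p : 'I_P) :
    'M[V]_(Nd p, (\prod_(q | q != p) Nd q)%N) :=
  \matrix_(j, c) \sum_(i : midx Nd | (i p == j) && (linidx (predC1 p) i == c)) X i.

End Tensors.

Definition ones (R : realType) (n : nat) : 'cV[R]_n := const_mx 1.

Definition dotv (R : realType) (n : nat) (u v : 'cV[R]_n) : R := (u^T *m v) 0 0.

Definition posv (R : realType) (n : nat) (v : 'cV[R]_n) : Prop :=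
  forall k, 0 < v k 0.

Section Model.
Variables (R : realType) (P : nat) (Nd : 'I_P -> nat).

Definition realT (X : tensor Nd nat) : tensor Nd R := [ffun i => (X i)%:R].

Definition outer (a : forall p, 'cV[R]_(Nd p)) : tensor Nd R :=
  [ffun i : midx Nd => \prod_p a p (i p) 0].

Definition factor (theta : 'cV[R]_(\sum_p Nd p)) (p : 'I_P) : 'cV[R]_(Nd p) :=
  submxcol theta p.

Definition mode_sum (X : tensor Nd nat) (p : 'I_P) : 'cV[R]_(Nd p) :=
  matricization (realT X) p *m ones R _.

Definition lambda_ (theta : 'cV[R]_(\sum_p Nd p)) (p : 'I_P) : R :=
  dotv (ones R _) (factor theta p).

Definition tensor_sum (X : tensor Nd nat) : R := dotv (ones R _) (vec (realT X)).

(* Log of the joint pmf of independent x_i ~ Poisson((a_1 o ... o a_P)_i). *)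
Definition loglik (X : tensor Nd nat) (theta : 'cV[R]_(\sum_p Nd p)) : R :=
  ln (\prod_(i : midx Nd) poisson_pmf (outer (factor theta) i) (X i)).

Definition feasible (X : tensor Nd nat) (theta : 'cV[R]_(\sum_p Nd p)) : Prop :=
  [/\ posv theta, \prod_p lambda_ theta p = tensor_sum X & 0 < tensor_sum X].

Definition maximizer (X : tensor Nd nat) (theta : 'cV[R]_(\sum_p Nd p)) : Prop :=
  feasible X theta /\
  forall theta', feasible X theta' -> loglik X theta' <= loglik X theta.

End Model.

Section MixedRadix.
Local Open Scope nat_scope.

Let S n (A : pred 'I_n) (r d : 'I_n -> nat) :=
  \sum_(q | A q) d q * \prod_(m | A m && (m < q)) r m.

Let SS n (A : pred 'I_n.+1) (r d : 'I_n.+1 -> nat) :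
  let w := widen_ord (leqnSn n) in
  S A r d = S (A \o w) (r \o w) (d \o w)
    + A ord_max * (d ord_max * \prod_(q | A (w q)) r (w q)).
Proof.
rewrite /S big_mkcond big_ord_recr /=; congr (_ + _).
  rewrite [RHS]big_mkcond /=; apply: eq_bigr => q _.
  case: ifP => // _; congr (_ * _).
  rewrite big_mkcond big_ord_recr /= [n < q]ltnNge ltnW // andbF muln1.
  by rewrite [RHS]big_mkcond.
case: (A ord_max); last by rewrite mul0n.
rewrite mul1n; congr (_ * _).
rewrite big_mkcond big_ord_recr /= ltnn andbF muln1 [RHS]big_mkcond /=.
by apply: eq_bigr => q _; rewrite ltn_ord andbT.
Qed.

Let prodS n (A : pred 'I_n.+1) (r : 'I_n.+1 -> nat) :
  let w := widen_ord (leqnSn n) in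
  \prod_(q | A q) r q =
  (\prod_(q | A (w q)) r (w q)) * (if A ord_max then r ord_max else 1).
Proof. by rewrite big_mkcond big_ord_recr /= [in RHS]big_mkcond. Qed.

Let S_lt n (A : pred 'I_n) (r d : 'I_n -> nat) :
  (forall q, A q -> d q < r q) -> S A r d < \prod_(q | A q) r q.
Proof.
elim: n A r d => [|n IH] A r d Hd; first by rewrite /S !big_ord0.
rewrite SS prodS /=.
have {IH} := IH (A \o _) (r \o _) (d \o _) (fun q => Hd (widen_ord (leqnSn n) q)).
set s := S _ _ _ => /= Hs; set T := bigop.body _ _ _ in Hs *.
case: ifP => [/Hd Hm|_]; last by rewrite mul0n addn0 muln1.
rewrite mul1n mulnC; apply: leq_trans (leq_mul (leqnn _) Hm).
by rewrite mulnS ltn_add2r.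
Qed.

Let S_inj n (A : pred 'I_n) (r d d' : 'I_n -> nat) :
  (forall q, A q -> d q < r q) -> (forall q, A q -> d' q < r q) ->
  S A r d = S A r d' -> forall q, A q -> d q = d' q.
Proof.
elim: n A r d d' => [|n IH] A r d d' Hd Hd' E q; first by case: q.
pose w := widen_ord (leqnSn n).
have Hs := @S_lt n (A \o w) (r \o w) (d \o w) (fun q => Hd (w q)).
have Hs' := @S_lt n (A \o w) (r \o w) (d' \o w) (fun q => Hd' (w q)).
move: E; rewrite !SS /= -/w; move: Hs Hs' => /=.
set T := bigop.body _ _ _; set s := S _ _ _; set s' := S _ _ _ => Hs Hs' E.
have T0 : 0 < T by apply: leq_ltn_trans Hs.
have Emod : s = s'.
  move: (congr1 (modn^~ T) E).
  by rewrite !mulnA ![s + _]addnC ![s' + _]addnC !modnMDl !modn_small.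
have {IH}Ew := IH (A \o w) (r \o w) _ _ (fun q => Hd (w q)) (fun q => Hd' (w q)) Emod.
case: (unliftP ord_max q) => [j|] ->.
  have -> : lift ord_max j = w j by apply/val_inj; rewrite /= /bump leqNgt ltn_ord.
  exact: Ew.
move=> Am; move: E; rewrite Am !mul1n Emod => /addnI /eqP.
by rewrite eqn_pmul2r // => /eqP.
Qed.

Lemma linidx_lt P (Nd : 'I_P -> nat) (A : pred 'I_P) (i : midx Nd) :
  linidx A i < \prod_(q | A q) Nd q.
Proof. by apply: (@S_lt _ _ _ (fun q => i q)) => q _. Qed.

Lemma linidx_inj P (Nd : 'I_P -> nat) (A : pred 'I_P) (i j : midx Nd) :
  linidx A i = linidx A j -> forall q, A q -> i q = j q.
Proof.
move=> E q Aq; apply: val_inj => /=.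
by apply: (S_inj (d := fun q => i q) (d' := fun q => j q) _ _ E).
Qed.

End MixedRadix.

Lemma matricizationE (V : nmodType) P (Nd : 'I_P -> nat) (X : tensor Nd V) p
    (i : midx Nd) :
  matricization X p (i p) (Ordinal (linidx_lt (predC1 p) i)) = X i.
Proof.
rewrite mxE (big_pred1 i) // => j; apply/andP/eqP => [[/eqP Ep /eqP E]|->] //=.
apply/ffunP => q; have [->//|qp] := eqVneq q p.
exact: (linidx_inj E).
Qed.

Lemma vecE (V : nmodType) P (Nd : 'I_P -> nat) (X : tensor Nd V) (i : midx Nd) :
  vec X (Ordinal (linidx_lt predT i)) 0 = X i.
Proof.
rewrite mxE (big_pred1 i) // => j; apply/eqP/eqP => [E|->] //=.
by apply/ffunP => q; exact: (linidx_inj E).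
Qed.

Lemma mode_sumE (R : realType) P (Nd : 'I_P -> nat) (X : tensor Nd nat) p j :
  mode_sum R X p j 0 = \sum_(i : midx Nd | i p == j) (X i)%:R.
Proof.
rewrite mxE [RHS](partition_big (fun i => Ordinal (linidx_lt (predC1 p) i)) predT) //=.
by apply: eq_bigr => c _; rewrite !mxE mulr1; apply: eq_bigr => i _; rewrite ffunE.
Qed.

Lemma tensor_sumE (R : realType) P (Nd : 'I_P -> nat) (X : tensor Nd nat) :
  tensor_sum R X = \sum_(i : midx Nd) (X i)%:R.
Proof.
rewrite /tensor_sum /dotv mxE.
rewrite [RHS](partition_big (fun i => Ordinal (linidx_lt predT i)) predT) //=.
by apply: eq_bigr => c _; rewrite !mxE mul1r; apply: eq_bigr => i _; rewrite ffunE.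
Qed.

(* Main.v *)
Require Import Defs.
From mathcomp Require Import all_boot all_order all_algebra.
From mathcomp Require Import reals exp poisson_distribution.
From mathcomp Require Import ring.
Import Order.TTheory GRing.Theory Num.Theory.
Local Open Scope ring_scope.

(** Up to a constant the loglikelihood is [\sum_p dotv x_p (ln a_p) - \prod_p
    lambda_p], and the constraint fixes the subtracted product, so only the
    first sum matters.  All the mode sums [x_p] have the same total
    [S = tensor_sum X], hence splitting each factor into its total [lambda_p]
    and the vector [y_p = S / lambda_p *: a_p] of total [S] turns that sum into
    [\sum_p dotv x_p (ln y_p) + S * (\sum_p ln lambda_p - P * ln S)], in which
    [\sum_p ln lambda_p = ln S] is again fixed by the constraint.  The [y_p] are
    only constrained to be positive of total [S], and Gibbs' inequality
    ([gibbs_leif]) bounds each [dotv x_p (ln y_p)] by [dotv x_p (ln x_p)], with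
    equality exactly when [y_p = x_p].  The resulting bound [loglik_bound] does
    not depend on the factors ([loglik_leif]) and is attained, so the maximizers
    are the feasible factors with [a_p = lambda_p / S *: x_p] for all [p].
    The scales [lambda_p] stay free, but their product is [S], so the outer
    product of the [a_p] is [S / S ^+ P] times that of the [x_p]. *)

Lemma ln_le_subr1 (R : realType) (t : R) : 0 < t ->
  ln t <= t - 1 ?= iff (t == 1).
Proof.
move=> t0; have [->|t1] := eqVneq t 1.
  by rewrite ln1 subrr; exact: leif_refl.
have l0 : ln t != 0 by rewrite ln_eq0.
have lt1 : ln t < t - 1 by rewrite ltrBrDl -{2}(lnK t0) expR_gt1Dx.
by split; [exact: ltW | rewrite lt_eqF].
Qed.

(** Termwise [ln t <= t - 1] at [t = y i / x i]: the slack [y i - x i] sums to 0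
    because the totals agree. *)
Lemma gibbs_leif (R : realType) (I : finType) (x y : I -> R) :
  (forall i, 0 < x i) -> (forall i, 0 < y i) -> \sum_i y i = \sum_i x i ->
  \sum_i x i * ln (y i) <= \sum_i x i * ln (x i)
    ?= iff [forall i, y i == x i].
Proof.
move=> x0 y0 yx.
have -> : \sum_i x i * ln (x i) = \sum_i (x i * ln (x i) + (y i - x i)).
  by rewrite big_split sumrB /= yx subrr addr0.
apply: (@leif_sum _ _ predT (fun i => y i == x i)) => i _.
have xn0 : x i != 0 by rewrite gt_eqF.
have -> : (y i == x i) = (y i / x i == 1).
  by rewrite -[RHS](inj_eq (mulIf xn0)) divfK// mul1r.
have {1}-> : y i = y i / x i * x i by rewrite divfK.
have -> : y i - x i = x i * (y i / x i - 1) by rewrite mulrBr mulr1 mulrC divfK.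
rewrite lnM ?posrE ?divr_gt0// addrC mulrDr (mono_leif (lerD2l _)).
rewrite (mono_leif (ler_pM2l (x0 i))).
by apply: ln_le_subr1; rewrite divr_gt0.
Qed.

Lemma ln_prod (R : realType) (I : finType) (F : I -> R) :
  (forall i, 0 < F i) -> ln (\prod_i F i) = \sum_i ln (F i).
Proof.
move=> F0; suff [] : 0 < \prod_i F i /\ ln (\prod_i F i) = \sum_i ln (F i) by [].
apply: (big_rec2 (fun u v : R => 0 < u /\ ln u = v)); first by rewrite ln1.
by move=> i u v _ [u0 <-]; rewrite mulr_gt0// lnM ?posrE.
Qed.

(** Distributivity over a product of index types that vary with [p]: [untag]
    extends each [a p] by 0 to the disjoint union of these types, which reduces
    it to distributivity over a fixed index type. *)
Lemma prod_sum_midx (R : realType) (P : nat) (Nd : 'I_P -> nat)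
    (a : forall p, 'I_(Nd p) -> R) :
  \prod_p \sum_j a p j = \sum_(i : midx Nd) \prod_p a p (i p).
Proof.
pose T (p : 'I_P) : finType := 'I_(Nd p).
pose b (p : 'I_P) : {ffun T p -> R} := [ffun j => a p j].
transitivity (\prod_p \sum_(j : T p) b p j).
  by apply: eq_bigr => p _; apply: eq_bigr => j _; rewrite ffunE.
transitivity (\prod_p \sum_(u in tagged_with T p) untag 0 (b p) u).
  by apply: eq_bigr => p _; exact: (big_tag (fun q => b q) p).
rewrite bigA_distr_big_dep -big_fprod.
rewrite (reindex _ (onW_bij _ (fprod_of_dffun_bij _))).
by apply: eq_bigr => i _; apply: eq_bigr => p _; rewrite fprodE ffunE.
Qed.

Section Model.
Context {R : realType} {P : nat} {Nd : 'I_P -> nat}.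
Implicit Types (X : tensor Nd nat) (theta : 'cV[R]_(\sum_p Nd p)).

Lemma dotvE n (u v : 'cV[R]_n) : dotv u v = \sum_k u k 0 * v k 0.
Proof. by rewrite /dotv mxE; apply: eq_bigr => k _; rewrite mxE. Qed.

Lemma lambda_E theta p : lambda_ theta p = \sum_j factor theta p j 0.
Proof. by rewrite /lambda_ dotvE; apply: eq_bigr => k _; rewrite mxE mul1r. Qed.

Lemma factor_gt0 theta p j : posv theta -> 0 < factor theta p j 0.
Proof. by move=> th0; rewrite mxE. Qed.

Lemma sum_mode_sum X p (F : 'I_(Nd p) -> R) :
  \sum_j mode_sum R X p j 0 * F j = \sum_(i : midx Nd) (X i)%:R * F (i p).
Proof.
rewrite [RHS](partition_big (fun i : midx Nd => i p) predT)//=.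
apply: eq_bigr => j _; rewrite mode_sumE mulr_suml.
by apply: eq_bigr => i /eqP ->.
Qed.

Lemma total_mode_sum X p : \sum_j mode_sum R X p j 0 = tensor_sum R X.
Proof.
rewrite -[LHS](eq_bigr _ (fun j _ => mulr1 _)) (sum_mode_sum X p (fun=> 1)).
by rewrite tensor_sumE; apply: eq_bigr => i _; rewrite mulr1.
Qed.

(** The factor entries enter the log of the mean of entry [i] additively, so
    summing over [i] regroups the data into mode sums; the means themselves add
    up to the product of the totals [lambda_p]. *)
Lemma loglikE X theta : posv theta ->
  loglik X theta =
    \sum_p \sum_j mode_sum R X p j 0 * ln (factor theta p j 0)
    - \prod_p lambda_ theta p - \sum_(i : midx Nd) ln (X i)`!%:R.
Proof.
move=> th0; have a0 p j : 0 < factor theta p j 0 by exact: factor_gt0.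
have out0 i : 0 < outer (factor theta) i by rewrite ffunE prodr_gt0.
have f0 n : 0 < n`!%:R :> R by rewrite ltr0n fact_gt0.
rewrite /loglik ln_prod => [|i]; last first.
  by rewrite /poisson_pmf out0 !mulr_gt0 ?exprn_gt0 ?invr_gt0 ?expR_gt0.
have -> : \prod_p lambda_ theta p = \sum_i outer (factor theta) i.
  under eq_bigr do rewrite lambda_E.
  rewrite prod_sum_midx.
  by apply: eq_bigr => i _; rewrite ffunE.
under [in RHS]eq_bigr => p _ do
  rewrite (sum_mode_sum X p (fun j => ln (factor theta p j 0))).
rewrite [X in _ = X - _ - _]exchange_big -!sumrB; apply: eq_bigr => i _ /=.
rewrite /poisson_pmf out0 !lnM ?posrE ?mulr_gt0 ?exprn_gt0 ?invr_gt0 ?expR_gt0//.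
rewrite expRK lnV ?posrE// lnXn// ffunE ln_prod//.
by rewrite -mulr_sumr mulr_natl addrAC.
Qed.

Lemma sum_factor_scale X theta p : lambda_ theta p != 0 ->
  \sum_j tensor_sum R X / lambda_ theta p * factor theta p j 0
    = tensor_sum R X.
Proof. by move=> l0; rewrite -mulr_sumr -lambda_E divfK. Qed.

(** The maximal value of the loglikelihood under the constraint; with
    [S = tensor_sum X], its second term is the value that the constraint forces
    on [S * (\sum_p ln lambda_p - P * ln S)] and its third that of
    [\prod_p lambda_p]. *)
Definition loglik_bound X : R :=
  \sum_p \sum_j mode_sum R X p j 0 * ln (mode_sum R X p j 0)
  + tensor_sum R X * (ln (tensor_sum R X) - ln (tensor_sum R X) *+ P)
  - tensor_sum R X - \sum_(i : midx Nd) ln (X i)`!%:R.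

(** Gibbs' inequality in each mode, for the factors rescaled to the common total
    [tensor_sum X] of the mode sums: the constraint makes the rescaling cost the
    same for all feasible factors. *)
Lemma loglik_leif X theta : (forall p, posv (mode_sum R X p)) ->
  feasible X theta ->
  loglik X theta <= loglik_bound X
    ?= iff [forall p, forall j,
              tensor_sum R X / lambda_ theta p * factor theta p j 0
                == mode_sum R X p j 0].
Proof.
move=> x0 [th0 lS S0]; set S := tensor_sum R X in lS S0 *.
have a0 p j : 0 < factor theta p j 0 by exact: factor_gt0.
(* A sum over a mode that may be empty: it is nonzero by the constraint. *)
have l0 p : 0 < lambda_ theta p.
  have l_ge0 : 0 <= lambda_ theta p.
    by rewrite lambda_E sumr_ge0// => j _; exact: ltW.
  rewrite lt_def l_ge0 andbT; apply: contraTneq S0 => l0.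
  by rewrite -lS (bigD1 p)//= l0 mul0r ltxx.
have y0 p j : 0 < S / lambda_ theta p * factor theta p j 0.
  by rewrite mulr_gt0// divr_gt0.
have rescale : \sum_p \sum_j mode_sum R X p j 0 * ln (factor theta p j 0) =
    \sum_p \sum_j mode_sum R X p j 0 *
      ln (S / lambda_ theta p * factor theta p j 0) + S * (ln S - ln S *+ P).
  have -> : S * (ln S - ln S *+ P) =
      \sum_p \sum_j mode_sum R X p j 0 * (ln (lambda_ theta p) - ln S).
    under [RHS]eq_bigr do rewrite -mulr_suml total_mode_sum.
    by rewrite -mulr_sumr sumrB sumr_const card_ord -ln_prod// lS.
  rewrite -big_split; apply: eq_bigr => p _; rewrite -big_split /=.
  apply: eq_bigr => j _; rewrite -mulrDr; congr (_ * _).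
  rewrite lnM ?posrE ?divr_gt0// ln_div ?posrE//.
  by rewrite addrC addrA addrA subrK subrr add0r.
rewrite loglikE// rescale lS /loglik_bound -/S.
rewrite !(mono_leif (lerD2r _)).
apply: (@leif_sum _ _ predT (fun p => [forall j, _ == _])) => p _.
apply: gibbs_leif => [j|j|]; [exact: x0 | exact: y0 |].
by rewrite sum_factor_scale ?gt_eqF// total_mode_sum.
Qed.

(** Take [a_p = lambda_p / S *: x_p] with [S = tensor_sum X]: only the product of
    the scales [lambda_p] is constrained, so [lambda_p0 = S] and 1 elsewhere will
    do. *)
Lemma loglik_bound_attained X (p0 : 'I_P) :
  (forall p, posv (mode_sum R X p)) -> 0 < tensor_sum R X ->
  exists2 theta, feasible X theta & loglik X theta = loglik_bound X.
Proof.
move=> x0 S0; set S := tensor_sum R X in S0 *.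
pose c p : R := if p == p0 then 1 else S^-1.
have c0 p : 0 < c p by rewrite /c; case: ifP; rewrite ?ltr01 ?invr_gt0.
pose theta : 'cV[R]_(\sum_p Nd p) := \mxcol_p (c p *: mode_sum R X p).
have thE p j : factor theta p j 0 = c p * mode_sum R X p j 0.
  by rewrite /factor mxcolK mxE.
have lE p : lambda_ theta p = c p * S.
  rewrite lambda_E; under eq_bigr do rewrite thE.
  by rewrite -mulr_sumr total_mode_sum.
have feas : feasible X theta.
  split=> //; first by move=> k; rewrite 2!mxE mulr_gt0// x0.
  rewrite (bigD1 p0)//= big1 => [|p pp0]; rewrite lE /c.
    by rewrite eqxx mul1r mulr1.
  by rewrite (negPf pp0) mulVf// gt_eqF.
exists theta => //; apply/eqP; rewrite (loglik_leif _ _ x0 feas).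
apply/forallP => p; apply/forallP => j; rewrite thE lE -/S.
by apply/eqP; field; rewrite !gt_eqF.
Qed.

End Model.

Theorem lemma2 (R : realType) (P : nat) (hP : (0 < P)%N) (Nd : 'I_P -> nat)
    (hN : forall p, (0 < Nd p)%N) (X : tensor Nd nat) :
  (exists C : R, forall theta : 'cV[R]_(\sum_p Nd p), posv theta ->
     loglik X theta =
       \sum_p dotv (mode_sum R X p) (map_mx (@ln R) (factor theta p))
       - \prod_p lambda_ theta p + C) /\
  ((forall p, posv (mode_sum R X p)) ->
   (exists theta : 'cV[R]_(\sum_p Nd p), maximizer X theta) /\
   (forall theta : 'cV[R]_(\sum_p Nd p), maximizer X theta ->
      forall i : midx Nd,
        outer (factor theta) i =
        (tensor_sum R X ^+ P.-1)^-1 * outer (mode_sum R X) i)).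
Proof.
split.
  exists (- \sum_(i : midx Nd) ln (X i)`!%:R) => theta th0.
  rewrite loglikE//; congr (_ - _ - _); apply: eq_bigr => p _.
  by rewrite dotvE; apply: eq_bigr => j _; rewrite [map_mx _ _ _ _]mxE.
move=> x0; pose p0 := Ordinal hP; pose j0 := Ordinal (hN p0).
have S0 : 0 < tensor_sum R X.
  rewrite -(total_mode_sum X p0) (bigD1 j0)//= ltr_pwDl ?x0//.
  by rewrite sumr_ge0// => j _; rewrite ltW ?x0.
have [opt opt_feas optE] := loglik_bound_attained X p0 x0 S0.
split=> [|theta [feas max_th] i].
  exists opt; split=> // theta feas.
  by rewrite optE (loglik_leif _ _ x0 feas).
have [le_bound eq_bound] := loglik_leif _ _ x0 feas.
have : loglik X theta == loglik_bound X.
  by rewrite eq_le le_bound -optE max_th.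
rewrite eq_bound => /forallP aE; case: feas => th0 lS _.
set S := tensor_sum R X in S0 lS aE *.
have Sn0 : S != 0 by rewrite gt_eqF.
have ln0 p : lambda_ theta p != 0.
  by apply: contraNneq Sn0 => l0; rewrite -lS (bigD1 p)//= l0 mul0r.
rewrite !ffunE.
have {}aE p : factor theta p (i p) 0 =
    lambda_ theta p * (S^-1 * mode_sum R X p (i p) 0).
  by move/forallP: (aE p) => /(_ (i p))/eqP <-; rewrite -/S; field; rewrite Sn0 ln0.
under eq_bigr do rewrite aE.
rewrite !big_split /= lS prodr_const card_ord mulrA; congr (_ * _).
have -> : S^-1 ^+ P = S^-1 * S^-1 ^+ P.-1 by rewrite -exprS prednK.
by rewrite mulVKf// exprVn.
Qed.
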